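(* Let $\alpha\in\mathbb{R}\setminus\mathbb{Q}$ with $0<\beta(\alpha)<\infty$, let $\eta>C_1\beta(\alpha)$, let $f$ be real analytic on $\mathbb{R}/\mathbb{Z}$ and analytic on the strip $\{z\in\mathbb{C}/\mathbb{Z}:|\Im z|\le C_2\eta\}$, and let $0<|\lambda|\le\lambda_0$, where $C_1,C_2$ and $\lambda_0=\lambda_0(f,\eta,\alpha)$ are as in the context. For $m\in\mathbb{Z}\setminus\{0\}$ let $G_m=(E_m^-,E_m^+)$ (with $G_m=\{E_m^-\}$ if $E_m^-=E_m^+$), and let $G_0=(-\infty,E_{\min})\cup(E_{\max},+\infty)$. Then there is a constant $c_\star>0$ depending only on $\lambda,f,\alpha$ such that for all $m,m'\in\mathbb{Z}\setminus\{0\}$ with $m'\ne m$ and $|m'|\ge|m|$, $$\mathrm{dist}(G_m,G_{m'})=\inf_{x\in G_m,\,x'\in G_{m'}}|x-x'|\ge c_\star e^{-8\beta(\alpha)|m'|},$$ and for all $m\in\mathbb{Z}\setminus\{0\}$, $$\mathrm{dist}(G_m,G_0)\ge c_\star e^{-8\beta(\alpha)|m|}.$$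
   Context: $(H_{\lambda f,\alpha,\theta}x)_n=x_{n+1}+x_{n-1}+\lambda f(\theta+n\alpha)x_n$ on $\ell^2(\mathbb{Z})$, with $\theta$-independent spectrum $\Sigma_{\lambda f,\alpha}$; $E_{\min}=\min\Sigma_{\lambda f,\alpha}$, $E_{\max}=\max\Sigma_{\lambda f,\alpha}$. $\beta(\alpha)=\limsup_{k\to\infty}\frac{-\ln\|k\alpha\|_{\mathbb{R}/\mathbb{Z}}}{|k|}$, $\|x\|_{\mathbb{R}/\mathbb{Z}}=\min_{k\in\mathbb{Z}}|x-k|$. With $S_{\lambda f,E}(x)=\begin{pmatrix}E-\lambda f(x)&-1\\1&0\end{pmatrix}$, $\rho_{\lambda f,\alpha}(E)\in[0,\frac12]$ is the fibered rotation number of the cocycle $(\alpha,S_{\lambda f,E})$, i.e. the average rotation (in units of $2\pi$) of directions under iteration of $(x,v)\mapsto(x+\alpha,S_{\lambda f,E}(x)v)$, normalized to be continuous and non-increasing in $E$ from $\frac12$ (for $E\le E_{\min}$) to $0$ (for $E\ge E_{\max}$); equivalently $1-2\rho_{\lambda f,\alpha}$ is the integrated density of states. For $m\ne0$, $[E_m^-,E_m^+]=\{E:2\rho_{\lambda f,\alpha}(E)=m\alpha\bmod\mathbb{Z}\}$. $C_1,C_2$ are fixed sufficiently large absolute constants and $\lambda_0=\lambda_0(f,\eta,\alpha)>0$ is a threshold for which the following known result (Liu–Yuan) holds: if $0<|\lambda|\le\lambda_0$, then $|\rho_{\lambda f,\alpha}(E_1)-\rho_{\lambda f,\alpha}(E_2)|\le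 C_\star|E_1-E_2|^{1/2}$ for all $E_1,E_2\in\mathbb{R}$, with $C_\star$ depending only on $\lambda,f,\alpha$. *)

(* Defs.v *)
From Stdlib Require Import Reals ZArith.
From Coquelicot Require Import Coquelicot.

Open Scope R_scope.

Definition irrational (alpha : R) : Prop :=
  forall p q : Z, q <> 0%Z -> alpha <> IZR p / IZR q.

Definition is_minimum (A : R -> Prop) (x : R) : Prop :=
  A x /\ forall y, A y -> x <= y.

Definition is_maximum (A : R -> Prop) (x : R) : Prop :=
  A x /\ forall y, A y -> y <= x.

(* Equals [p_infty] when one of the sets is empty. *)
Definition set_dist (A B : R -> Prop) : Rbar :=
  Glb_Rbar (fun d => exists x x', A x /\ B x' /\ d = Rabs (x - x')).

Definition dist_Z (x : R) : R :=
  real (Glb_Rbar (fun d => exists k : Z, d = Rabs (x - IZR k))).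

(* The quotient is even in k, so it is enough to let k range over nat. *)
Definition beta (alpha : R) : Rbar :=
  LimSup_seq (fun k : nat => - ln (dist_Z (INR k * alpha)) / INR k).

Definition analytic_at {K : AbsRing} {V : NormedModule K}
    (F : K -> V) (z : K) : Prop :=
  exists a : nat -> V, locally z (fun w => is_pseries a (minus w z) (F w)).

Definition one_periodic (f : R -> R) : Prop := forall x, f (x + 1) = f x.

Definition real_analytic (f : R -> R) : Prop :=
  forall x : R, @analytic_at R_AbsRing R_NormedModule f x.

(* Analyticity at a boundary point of the closed strip refers to a full
   complex neighbourhood of that point. *)
Definition analytic_on_strip (f : R -> R) (h : R) : Prop :=
  exists F : C -> C,
    (forall x : R, F (RtoC x) = RtoC (f x)) /\
    (forall z : C, Rabs (Im z) <= h ->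
       F (z + 1)%C = F z /\ @analytic_at C_AbsRing C_NormedModule F z).

Definition in_l2 (u : Z -> C) : Prop :=
  ex_series (fun n : nat => Cmod (u (Z.of_nat n)) ^ 2) /\
  ex_series (fun n : nat => Cmod (u (- Z.of_nat (S n))%Z) ^ 2).

Definition l2_norm (u : Z -> C) : R :=
  sqrt (Series (fun n : nat => Cmod (u (Z.of_nat n)) ^ 2) +
        Series (fun n : nat => Cmod (u (- Z.of_nat (S n))%Z) ^ 2)).

Definition schrodinger (lam : R) (f : R -> R) (alpha theta : R)
    (u : Z -> C) : Z -> C :=
  fun n => (u (n + 1)%Z + u (n - 1)%Z
            + RtoC (lam * f (theta + IZR n * alpha))%R * u n)%C.

(* T - z has a bounded two-sided inverse on l^2(Z); operators on l^2(Z) are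
   represented by maps on all sequences, of which only the restriction to
   l^2(Z) matters.  Linearity of B on l^2(Z) follows from that of T. *)
Definition in_resolvent_set (T : (Z -> C) -> (Z -> C)) (z : C) : Prop :=
  let Tz := fun (u : Z -> C) (n : Z) => (T u n - z * u n)%C in
  exists (B : (Z -> C) -> (Z -> C)) (M : R),
    forall u, in_l2 u ->
      in_l2 (B u) /\ l2_norm (B u) <= M * l2_norm u /\
      (forall n, Tz (B u) n = u n) /\ (forall n, B (Tz u) n = u n).

Definition spectrum (T : (Z -> C) -> (Z -> C)) (z : C) : Prop :=
  ~ in_resolvent_set T z.

(* The operator is self-adjoint, so its spectrum is real; for irrational alpha
   and continuous f it does not depend on the phase, taken here to be 0. *)
Definition Sigma (lam : R) (f : R -> R) (alpha : R) (E : R) : Prop :=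
  spectrum (schrodinger lam f alpha 0) (RtoC E).

(* Action on v of the matrix with rows (E - lam f(x), -1) and (1, 0). *)
Definition cocycle (lam : R) (f : R -> R) (E x : R) (v : R * R) : R * R :=
  ((E - lam * f x) * fst v - snd v, fst v).

Definition direction (phi : R) : R * R :=
  (cos (2 * PI * phi), sin (2 * PI * phi)).

(* phi |-> phi + psi x phi is a continuous lift of the action of A x on
   directions, measured in units of 2 pi. *)
Definition is_lift (A : R -> R * R -> R * R) (psi : R -> R -> R) : Prop :=
  (forall p : R * R, continuous (fun q : R * R => psi (fst q) (snd q)) p) /\
  (forall x phi : R, exists r : R, 0 < r /\
     A x (direction phi) =
       (r * fst (direction (phi + psi x phi)),
        r * snd (direction (phi + psi x phi)))).

Fixpoint lift_iter (alpha : R) (psi : R -> R -> R) (x phi : R) (n : nat) : R :=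
  match n with
  | O => phi
  | S k => lift_iter alpha psi x phi k
           + psi (x + INR k * alpha) (lift_iter alpha psi x phi k)
  end.

(* Continuous lifts are unique up to an additive integer constant, so the
   average rotation is determined modulo Z, and the requirement that it lie in
   [0, 1/2] determines it.  Counterclockwise rotation is positive, which gives
   the value 1/2 for very negative E and 0 for large E. *)
Definition is_fibered_rotation_number (lam : R) (f : R -> R) (alpha : R)
    (rho : R -> R) : Prop :=
  forall E : R,
    0 <= rho E <= 1 / 2 /\
    exists psi : R -> R -> R,
      is_lift (cocycle lam f E) psi /\
      forall x phi : R,
        is_lim_seq (fun n => (lift_iter alpha psi x phi n - phi) / INR n)
                   (rho E).

(* The theorem of Liu and Yuan, as the property that singles out the constants
   C1, C2 and the threshold lambda0 = lambda0(f, eta, alpha). *)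
Definition LiuYuan_constants (C1 C2 : R)
    (lambda0 : (R -> R) -> R -> R -> R) : Prop :=
  0 < C1 /\ 0 < C2 /\
  forall (alpha eta : R) (f : R -> R),
    irrational alpha ->
    Rbar_lt 0 (beta alpha) -> Rbar_lt (beta alpha) p_infty ->
    C1 * real (beta alpha) < eta ->
    one_periodic f -> real_analytic f -> analytic_on_strip f (C2 * eta) ->
    0 < lambda0 f eta alpha /\
    forall (lam : R) (rho : R -> R),
      0 < Rabs lam <= lambda0 f eta alpha ->
      is_fibered_rotation_number lam f alpha rho ->
      exists Cstar : R, forall E1 E2 : R,
        Rabs (rho E1 - rho E2) <= Cstar * sqrt (Rabs (E1 - E2)).

Definition is_gap_endpoints (alpha : R) (rho : R -> R)
    (Em Ep : Z -> R) : Prop :=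
  forall m : Z, m <> 0%Z ->
    Em m <= Ep m /\
    forall E : R,
      Em m <= E <= Ep m <-> exists k : Z, 2 * rho E = IZR m * alpha + IZR k.

Definition gap (Em Ep : Z -> R) (m : Z) (E : R) : Prop :=
  (Em m < E < Ep m) \/ (Em m = Ep m /\ E = Em m).

Definition gap0 (Emin Emax : R) (E : R) : Prop := E < Emin \/ Emax < E.

(* Main.v *)
(* By Hoelder continuity of [rho], it is enough that the values of [2 rho] on two gaps
   differ by at least the distance of a nonzero multiple [p alpha] to [Z], which is at least
   [c exp (- 2 beta |p|)] by definition of [beta].  For [G_0] this requires [2 rho] to be an
   integer below [Emin] and above [Emax].  There [H - E] is definite on finitely supported sequences.
   If [u] is the solution with [u_0 = 0], [u_(-1) = 1], and [w] is its truncation to [1..n],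
   then [<w, (H - E) w> = - u_n u_(n+1)], so [u] has constant sign above the spectrum and
   alternates below it; the lifted direction of [(u_n, u_(n-1))] then advances by half-turns
   at an integral rate. *)

Require Import Defs.
From Stdlib Require Import Reals ZArith Lra Lia Psatz Classical FunctionalExtensionality.
From Coquelicot Require Import Coquelicot.

Open Scope R_scope.

(** * Multiples of an irrational, and bounds on the potential *)

Lemma le_Glb_Rbar (A : R -> Prop) (c : R) :
  (forall x, A x -> c <= x) -> Rbar_le c (Glb_Rbar A).
Proof.
  intro H. apply (proj2 (Glb_Rbar_correct A)). intros x Hx. exact (H x Hx).
Qed.

Lemma le_real_Glb_Rbar (A : R -> Prop) (x0 c : R) :
  A x0 -> (forall x, A x -> c <= x) -> c <= real (Glb_Rbar A).
Proof.
  intros Hx0 H. pose proof (le_Glb_Rbar A c H) as Hc.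
  pose proof (proj1 (Glb_Rbar_correct A) x0 Hx0) as H0.
  destruct (Glb_Rbar A); simpl in *; easy.
Qed.

Lemma dist_Z_le (x : R) (k : Z) : dist_Z x <= Rabs (x - IZR k).
Proof.
  unfold dist_Z. set (A := fun d => _).
  pose proof (proj1 (Glb_Rbar_correct A) (Rabs (x - IZR k)) (ex_intro _ k eq_refl)) as H.
  assert (H0 : Rbar_le 0 (Glb_Rbar A)).
  { apply le_Glb_Rbar. intros y [j ->]. apply Rabs_pos. }
  destruct (Glb_Rbar A); simpl in *; easy.
Qed.

Lemma dist_Z_pos (x : R) : (forall k : Z, x <> IZR k) -> 0 < dist_Z x.
Proof.
  intro Hx. destruct (base_Int_part x) as [H1 H2].
  pose proof (Hx (Int_part x)) as H3.
  set (k := Int_part x) in *.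
  apply Rlt_le_trans with (Rmin (x - IZR k) (IZR k + 1 - x)).
  { apply Rmin_glb_lt; lra. }
  unfold dist_Z. apply le_real_Glb_Rbar with (Rabs (x - IZR 0)).
  { now exists 0%Z. }
  intros y [j ->]. destruct (Z_le_gt_dec j k) as [Hj | Hj].
  - apply IZR_le in Hj. pose proof (Rmin_l (x - IZR k) (IZR k + 1 - x)).
    rewrite Rabs_right; lra.
  - assert (Hj' : (k + 1 <= j)%Z) by lia. apply IZR_le in Hj'.
    rewrite plus_IZR in Hj'. pose proof (Rmin_r (x - IZR k) (IZR k + 1 - x)).
    rewrite Rabs_left1; lra.
Qed.

Lemma irrational_multiple (alpha : R) (k : nat) :
  irrational alpha -> (0 < k)%nat -> forall j : Z, INR k * alpha <> IZR j.
Proof.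
  intros Ha Hk j Hj. apply (Ha j (Z.of_nat k)); [lia |].
  rewrite <- INR_IZR_INZ, <- Hj. apply lt_INR in Hk. simpl in Hk. field. lra.
Qed.

Lemma pos_lower_bound_initial (d : nat -> R) (N : nat) :
  (forall k, (0 < k)%nat -> 0 < d k) ->
  exists c, 0 < c /\ forall k, (0 < k < N)%nat -> c <= d k.
Proof.
  intro Hd. induction N as [| N [c [Hc H]]].
  - exists 1. split; [lra | intros; lia].
  - destruct N as [| N].
    + exists 1. split; [lra | intros; lia].
    + exists (Rmin c (d (S N))). split.
      * apply Rmin_glb_lt; [easy | apply Hd; lia].
      * intros k Hk. destruct (Nat.eq_dec k (S N)) as [-> | Hne].
        -- apply Rmin_r.
        -- eapply Rle_trans; [apply Rmin_l | apply H; lia].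
Qed.

Lemma dist_Z_multiple_lower_bound (alpha : R) :
  irrational alpha -> Rbar_lt 0 (beta alpha) -> Rbar_lt (beta alpha) p_infty ->
  exists c, 0 < c /\ forall k : nat, (0 < k)%nat ->
    c * exp (- 2 * real (beta alpha) * INR k) <= dist_Z (INR k * alpha).
Proof.
  intros Ha H0 Hinf.
  set (u := fun k : nat => - ln (dist_Z (INR k * alpha)) / INR k).
  assert (Hu : is_LimSup_seq u (beta alpha)).
  { unfold beta, LimSup_seq. fold u. now destruct (ex_LimSup_seq u). }
  destruct (beta alpha) as [b | |]; simpl in H0, Hinf; try easy.
  destruct (Hu (mkposreal b H0)) as [_ [N HN]]. simpl in HN.
  assert (Hd : forall k, (0 < k)%nat -> 0 < dist_Z (INR k * alpha)).
  { intros k Hk. apply dist_Z_pos. now apply irrational_multiple. }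
  destruct (pos_lower_bound_initial _ N Hd) as [c [Hc Hck]].
  exists (Rmin c 1). split; [apply Rmin_glb_lt; lra |].
  intros k Hk. simpl.
  assert (HK : 0 < INR k) by (apply lt_INR in Hk; exact Hk).
  pose proof (exp_pos (- 2 * b * INR k)) as He.
  destruct (le_lt_dec N k) as [HNk | HNk].
  - specialize (HN k HNk). unfold u in HN.
    apply Rle_trans with (1 * exp (- 2 * b * INR k)).
    { apply Rmult_le_compat_r; [lra | apply Rmin_r]. }
    rewrite Rmult_1_l. rewrite <- (exp_ln (dist_Z (INR k * alpha))) by auto.
    left. apply exp_increasing.
    apply (Rmult_lt_compat_r (INR k)) in HN; [| easy].
    replace (- ln (dist_Z (INR k * alpha)) / INR k * INR k)
      with (- ln (dist_Z (INR k * alpha))) in HN by (field; lra).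
    lra.
  - apply Rle_trans with (c * 1); [| rewrite Rmult_1_r; apply Hck; lia].
    apply Rmult_le_compat.
    + apply Rmin_glb; lra.
    + lra.
    + apply Rmin_l.
    + rewrite <- exp_0. left. apply exp_increasing. nra.
Qed.

Lemma real_analytic_continuity (f : R -> R) : real_analytic f -> continuity f.
Proof.
  intros Hf x. destruct (Hf x) as [a [eps Ha]].
  assert (Hr : Rbar_lt (Rabs 0) (CV_radius a)).
  { apply Rbar_lt_le_trans with (Rabs (eps / 2)).
    - pose proof (cond_pos eps). simpl. rewrite Rabs_R0, Rabs_right; lra.
    - apply Rbar_not_lt_le. intro Hlt. apply (CV_disk_outside _ _ Hlt).
      apply ex_series_lim_0. exists (f (x + eps / 2)).
      apply is_pseries_R.
      replace (eps / 2) with (minus (x + eps / 2) x).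
      2:{ unfold minus, plus, opp; simpl. ring. }
      replace (x + minus (x + eps / 2) x) with (x + eps / 2).
      2:{ unfold minus, plus, opp; simpl. ring. }
      apply (Ha (x + eps / 2)).
      change (Rabs (x + eps / 2 - x) < eps). pose proof (cond_pos eps).
      replace (x + eps / 2 - x) with (eps / 2) by ring. rewrite Rabs_right; lra. }
  apply continuity_pt_ext_loc with (fun y => PSeries a (y - x)).
  - exists eps. intros y Hy. apply is_pseries_unique. exact (Ha y Hy).
  - apply (continuity_pt_comp (fun y => y - x) (PSeries a)).
    + apply continuity_pt_minus.
      * apply derivable_continuous_pt, derivable_pt_id.
      * apply continuity_pt_const. now intros ? ?.
    + apply PSeries_continuity. replace (x - x) with 0 by ring. exact Hr.
Qed.

Lemma one_periodic_IZR (f : R -> R) : one_periodic f -> forall (k : Z) x, f (x + IZR k) = f x.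
Proof.
  intros Hf k. apply (Z.bi_induction (fun k => forall x, f (x + IZR k) = f x)).
  - now intros ? ? ->.
  - intro x. now rewrite Rplus_0_r.
  - intro j. unfold Z.succ. split; intros H x.
    + rewrite plus_IZR, <- Rplus_assoc, Hf. apply H.
    + rewrite <- (H x), plus_IZR, <- Rplus_assoc. symmetry. apply Hf.
Qed.

Lemma periodic_continuous_bounded (f : R -> R) :
  one_periodic f -> continuity f -> exists V, forall x, Rabs (f x) <= V.
Proof.
  intros Hp Hc.
  destruct (continuity_ab_maj (fun x => Rabs (f x)) 0 1) as [y [Hy _]]; [lra | |].
  - intros c _. apply (continuity_pt_comp f Rabs); [apply Hc | apply Rcontinuity_abs].
  - exists (Rabs (f y)). intro x. destruct (base_Int_part x) as [H1 H2].
    replace (f x) with (f (x - IZR (Int_part x))).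
    + apply Hy. lra.
    + rewrite <- (one_periodic_IZR f Hp (Int_part x)). f_equal. ring.
Qed.

(** * Quadratic form bounds from the resolvent *)

(* The window [-(N+1), N] is chosen to match the two series of [l2_norm]. *)
Definition sumZ (N : nat) (g : Z -> R) : R :=
  sum_f_R0 (fun n => g (Z.of_nat n)) N + sum_f_R0 (fun n => g (- Z.of_nat (S n))%Z) N.

Definition supported (N : nat) (w : Z -> R) : Prop :=
  forall n : Z, (n > Z.of_nat N \/ n < - Z.of_nat (S N))%Z -> w n = 0.

Definition jacobi (s : R) (v : Z -> R) (w : Z -> R) : Z -> R :=
  fun n => s * (w (n + 1)%Z + w (n - 1)%Z) + v n * w n.

Lemma sumZ_S (N : nat) (g : Z -> R) :
  sumZ (S N) g = sumZ N g + g (Z.of_nat (S N)) + g (- Z.of_nat (S (S N)))%Z.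
Proof. unfold sumZ. rewrite !tech5. ring. Qed.

Lemma sumZ_ext (N : nat) (g h : Z -> R) : (forall n, g n = h n) -> sumZ N g = sumZ N h.
Proof. intro H. f_equal. now apply functional_extensionality. Qed.

Lemma sumZ_le (N : nat) (g h : Z -> R) : (forall n, g n <= h n) -> sumZ N g <= sumZ N h.
Proof. intro H. unfold sumZ. apply Rplus_le_compat; apply sum_Rle; auto. Qed.

Lemma sumZ_lin (N : nat) (a b : R) (g h : Z -> R) :
  sumZ N (fun n => a * g n + b * h n) = a * sumZ N g + b * sumZ N h.
Proof.
  induction N as [| N IH].
  - unfold sumZ. simpl. ring.
  - rewrite !sumZ_S, IH. ring.
Qed.

Lemma sumZ_telescope (N : nat) (h : Z -> R) :
  sumZ N (fun n => h n - h (n - 1)%Z) = h (Z.of_nat N) - h (- Z.of_nat (S (S N)))%Z.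
Proof.
  induction N as [| N IH].
  - unfold sumZ. simpl. ring.
  - rewrite sumZ_S, IH.
    replace (Z.of_nat (S N) - 1)%Z with (Z.of_nat N) by lia.
    replace (- Z.of_nat (S (S N)) - 1)%Z with (- Z.of_nat (S (S (S N))))%Z by lia.
    ring.
Qed.

Lemma sumZ_sqr_nonneg (N : nat) (w : Z -> R) : 0 <= sumZ N (fun n => w n ^ 2).
Proof.
  replace 0 with (sumZ N (fun n => 0 * 0 + 0 * 0)).
  - apply sumZ_le. intro n. pose proof (pow2_ge_0 (w n)). lra.
  - rewrite (sumZ_lin N 0 0 (fun _ => 0) (fun _ => 0)). ring.
Qed.

Lemma supported_S (N : nat) (w : Z -> R) : supported N w -> supported (S N) w.
Proof. intros H n Hn. apply H. lia. Qed.

Lemma supported_lin (N : nat) (a b : R) (w z : Z -> R) :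
  supported N w -> supported N z -> supported N (fun n => a * w n + b * z n).
Proof. intros Hw Hz n Hn. rewrite Hw, Hz by easy. ring. Qed.

Lemma supported_jacobi (s : R) (v w : Z -> R) (N : nat) :
  supported N w -> supported (S N) (jacobi s v w).
Proof. intros H n Hn. unfold jacobi. rewrite !H by lia. ring. Qed.

Lemma sumZ_supported_S (N : nat) (w z : Z -> R) :
  supported N w -> sumZ (S N) (fun n => w n * z n) = sumZ N (fun n => w n * z n).
Proof. intro H. rewrite sumZ_S, !H by lia. ring. Qed.

Lemma jacobi_symmetric (s : R) (v w z : Z -> R) (N : nat) :
  supported N w -> supported N z ->
  sumZ N (fun n => w n * jacobi s v z n) = sumZ N (fun n => z n * jacobi s v w n).
Proof.
  intros Hw Hz.
  pose (h := fun n : Z => w n * z (n + 1)%Z - z n * w (n + 1)%Z).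
  rewrite (sumZ_ext N (fun n => w n * jacobi s v z n)
    (fun n => 1 * (z n * jacobi s v w n) + s * (h n - h (n - 1)%Z))).
  - rewrite (sumZ_lin N 1 s (fun n => z n * jacobi s v w n) (fun n => h n - h (n - 1)%Z)).
    rewrite sumZ_telescope. unfold h.
    rewrite (Hw (Z.of_nat N + 1)%Z), (Hz (Z.of_nat N + 1)%Z) by lia.
    rewrite (Hw (- Z.of_nat (S (S N)))%Z), (Hz (- Z.of_nat (S (S N)))%Z) by lia.
    ring.
  - intro n. unfold h, jacobi. rewrite !Z.sub_add. ring.
Qed.

Lemma jacobi_form_le (s V : R) (v w : Z -> R) (N : nat) :
  s = 1 \/ s = -1 -> (forall n, Rabs (v n) <= V) -> supported N w ->
  sumZ N (fun n => w n * jacobi s v w n) <= (2 + V) * sumZ N (fun n => w n ^ 2).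
Proof.
  intros Hs HV Hw.
  pose (h := fun n : Z => (w (n + 1)%Z ^ 2 - w n ^ 2) / 2).
  apply Rle_trans with (sumZ N (fun n => (2 + V) * w n ^ 2 + 1 * (h n - h (n - 1)%Z))).
  - apply sumZ_le. intro n. unfold h, jacobi. rewrite !Z.sub_add.
    assert (Hv : - V <= v n <= V) by (apply Rabs_le_between; auto).
    pose proof (pow2_ge_0 (w n)) as H0.
    assert (H1 : v n * w n ^ 2 <= V * w n ^ 2) by (apply Rmult_le_compat_r; lra).
    pose proof (pow2_ge_0 (w n - w (n + 1)%Z)). pose proof (pow2_ge_0 (w n - w (n - 1)%Z)).
    pose proof (pow2_ge_0 (w n + w (n + 1)%Z)). pose proof (pow2_ge_0 (w n + w (n - 1)%Z)).
    destruct Hs as [-> | ->]; lra.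
  - rewrite (sumZ_lin N (2 + V) 1 (fun n => w n ^ 2) (fun n => h n - h (n - 1)%Z)).
    rewrite sumZ_telescope. unfold h.
    rewrite (Hw (Z.of_nat N + 1)%Z), (Hw (- Z.of_nat (S (S N)))%Z) by lia.
    pose proof (pow2_ge_0 (w (Z.of_nat N))).
    pose proof (pow2_ge_0 (w (- Z.of_nat (S (S N)) + 1)%Z)). lra.
Qed.

Lemma jacobi_form_ge (s V : R) (v w : Z -> R) (N : nat) :
  s = 1 \/ s = -1 -> (forall n, Rabs (v n) <= V) -> supported N w ->
  - (2 + V) * sumZ N (fun n => w n ^ 2) <= sumZ N (fun n => w n * jacobi s v w n).
Proof.
  intros Hs HV Hw.
  assert (H : sumZ N (fun n => w n * jacobi (- s) (fun n => - v n) w n)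
            <= (2 + V) * sumZ N (fun n => w n ^ 2)).
  { apply jacobi_form_le; [lra | | easy]. intro n. now rewrite Rabs_Ropp. }
  rewrite (sumZ_ext N _ (fun n => -1 * (w n * jacobi s v w n) + 0 * 0)) in H.
  - rewrite (sumZ_lin N (-1) 0 (fun n => w n * jacobi s v w n) (fun _ => 0)) in H. lra.
  - intro n. unfold jacobi. ring.
Qed.

(* If the optimal bound [a] were below [a0], then [P = J - a] would be nonnegative and bounded
   by [L], so [|P w|^2 <= L <w, P w>] (from [0 <= <z, P z>] with [z = w - P w / L]); the
   inverse bound at [a] then turns this into a strict improvement of [a]. *)
Lemma jacobi_form_lower_bound (s V a0 : R) (v : Z -> R) :
  s = 1 \/ s = -1 -> (forall n, Rabs (v n) <= V) ->
  (forall a, a < a0 -> exists M, forall N w, supported N w ->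
     sumZ (S N) (fun n => w n ^ 2)
     <= M * sumZ (S N) (fun n => (jacobi s v w n - a * w n) ^ 2)) ->
  forall N w, supported N w ->
    a0 * sumZ N (fun n => w n ^ 2) <= sumZ N (fun n => w n * jacobi s v w n).
Proof.
  intros Hs HV Hres.
  set (E := fun a => forall N w, supported N w ->
    a * sumZ N (fun n => w n ^ 2) <= sumZ N (fun n => w n * jacobi s v w n)).
  assert (HE : forall a, E a -> a <= V).
  { intros a Ha. pose (w := fun n : Z => if (n =? 0)%Z then 1 else 0).
    assert (Hw : supported 0 w).
    { intros n Hn. unfold w. destruct (Z.eqb_spec n 0); [lia | easy]. }
    specialize (Ha 0%nat w Hw). unfold sumZ, jacobi, w in Ha. simpl in Ha.
    assert (Hv : - V <= v 0%Z <= V) by (apply Rabs_le_between; auto). lra. }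
  destruct (completeness E) as [a [Hub Hlub]].
  { exists V. exact HE. }
  { exists (- (2 + V)). intros N w Hw. now apply jacobi_form_ge. }
  assert (Ha : E a).
  { intros N w Hw. destruct (sumZ_sqr_nonneg N w) as [H | H].
    - assert (Hq : a <= sumZ N (fun n => w n * jacobi s v w n) / sumZ N (fun n => w n ^ 2)).
      { apply Hlub. intros b Hb. apply Rle_div_r; [easy |]. now apply Hb. }
      apply Rle_div_r in Hq; easy.
    - pose proof (jacobi_form_ge s V v w N Hs HV Hw) as H1.
      rewrite <- H in *. lra. }
  assert (Haa : a0 <= a).
  { apply Rnot_lt_le. intro Hlt. destruct (Hres a Hlt) as [M HM].
    pose proof (HE a Ha) as HaV.
    set (L := 2 + V - a). assert (HL : 2 <= L) by (unfold L; lra).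
    set (M1 := Rmax M 1). assert (HM1 : 1 <= M1) by apply Rmax_r.
    assert (Hd : 0 < / (M1 * L)) by (apply Rinv_0_lt_compat; nra).
    assert (Hnew : E (a + / (M1 * L))).
    { intros N w Hw. specialize (HM N w Hw).
      set (p := fun n => jacobi s v w n - a * w n) in *.
      assert (HwK := supported_S N w Hw).
      assert (Hp : supported (S N) p).
      { intros n Hn. unfold p. rewrite (supported_jacobi s v w N Hw n Hn), (HwK n Hn). ring. }
      set (K := S N) in *.
      pose (z := fun n => 1 * w n + (- / L) * p n).
      assert (Hz : supported K z) by now apply supported_lin.
      pose proof (Ha K z Hz) as H1.
      pose proof (jacobi_form_le s V v p K Hs HV Hp) as H2.
      pose proof (jacobi_symmetric s v w p K HwK Hp) as H3.
      pose proof (sumZ_sqr_nonneg K p) as HZ.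
      set (X := sumZ K (fun n => w n ^ 2)) in *.
      set (Z := sumZ K (fun n => p n ^ 2)) in *.
      set (Q := sumZ K (fun n => w n * jacobi s v w n)).
      set (T := sumZ K (fun n => p n * jacobi s v p n)) in *.
      set (U := sumZ K (fun n => w n * jacobi s v p n)) in *.
      set (W := sumZ K (fun n => w n * p n)).
      assert (EQ : Q = W + a * X).
      { unfold Q. rewrite (sumZ_ext K _ (fun n => 1 * (w n * p n) + a * (w n ^ 2))).
        - rewrite (sumZ_lin K 1 a (fun n => w n * p n) (fun n => w n ^ 2)).
          fold X W. ring.
        - intro n. unfold p. ring. }
      assert (EU : U = Z + a * W).
      { rewrite H3. rewrite (sumZ_ext K _ (fun n => 1 * (p n ^ 2) + a * (w n * p n))).
        - rewrite (sumZ_lin K 1 a (fun n => p n ^ 2) (fun n => w n * p n)).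
          fold Z W. ring.
        - intro n. unfold p. ring. }
      assert (Ezz : sumZ K (fun n => z n ^ 2) = X - 2 / L * W + / L ^ 2 * Z).
      { rewrite (sumZ_ext K _ (fun n => 1 * (1 * (w n ^ 2) + (- 2 / L) * (w n * p n))
                                        + / L ^ 2 * (p n ^ 2))).
        - rewrite (sumZ_lin K 1 (/ L ^ 2)
            (fun n => 1 * (w n ^ 2) + (- 2 / L) * (w n * p n)) (fun n => p n ^ 2)).
          rewrite (sumZ_lin K 1 (- 2 / L) (fun n => w n ^ 2) (fun n => w n * p n)).
          fold X W Z. field. lra.
        - intro n. unfold z. field. lra. }
      assert (EzJ : sumZ K (fun n => z n * jacobi s v z n)
                    = Q - / L * (U + U) + / L ^ 2 * T).
      { rewrite (sumZ_ext K _ (fun n => 1 * (1 * (w n * jacobi s v w n)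
              + (- / L) * (1 * (w n * jacobi s v p n) + 1 * (p n * jacobi s v w n)))
              + / L ^ 2 * (p n * jacobi s v p n))).
        - rewrite (sumZ_lin K 1 (/ L ^ 2) (fun n => 1 * (w n * jacobi s v w n)
              + (- / L) * (1 * (w n * jacobi s v p n) + 1 * (p n * jacobi s v w n)))
              (fun n => p n * jacobi s v p n)).
          rewrite (sumZ_lin K 1 (- / L) (fun n => w n * jacobi s v w n)
              (fun n => 1 * (w n * jacobi s v p n) + 1 * (p n * jacobi s v w n))).
          rewrite (sumZ_lin K 1 1 (fun n => w n * jacobi s v p n)
              (fun n => p n * jacobi s v w n)).
          rewrite <- H3. fold Q U T. ring.
        - intro n. unfold z, jacobi. field. lra. }
      rewrite Ezz, EzJ in H1.
      assert (HiL : 0 < / L) by (apply Rinv_0_lt_compat; lra).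
      assert (HY : Z <= L * W).
      { assert (H4 : / L ^ 2 * (T - a * Z) <= / L ^ 2 * (L * Z)).
        { apply Rmult_le_compat_l.
          - left. apply Rinv_0_lt_compat. nra.
          - unfold L. lra. }
        replace (/ L ^ 2 * (L * Z)) with (/ L * Z) in H4 by (field; lra).
        assert (H5 : / L * Z <= W) by (unfold Rdiv in H1; nra).
        apply (Rmult_le_compat_l L) in H5; [| lra].
        replace (L * (/ L * Z)) with Z in H5 by (field; lra). exact H5. }
      assert (HX : X <= M1 * L * W).
      { apply Rle_trans with (M1 * Z).
        - apply Rle_trans with (M * Z); [exact HM |].
          apply Rmult_le_compat_r; [easy | apply Rmax_l].
        - rewrite Rmult_assoc. apply Rmult_le_compat_l; lra. }
      rewrite <- (sumZ_supported_S N w (jacobi s v w) Hw).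
      rewrite (sumZ_ext N (fun n => w n ^ 2) (fun n => w n * w n)) by (intro; ring).
      rewrite <- (sumZ_supported_S N w w Hw). fold K.
      rewrite (sumZ_ext K (fun n => w n * w n) (fun n => w n ^ 2)) by (intro; ring).
      fold X Q. rewrite EQ.
      apply (Rmult_le_compat_l (/ (M1 * L))) in HX; [| lra].
      replace (/ (M1 * L) * (M1 * L * W)) with W in HX by (field; lra). lra. }
    specialize (Hub _ Hnew). lra. }
  intros N w Hw. pose proof (Ha N w Hw). pose proof (sumZ_sqr_nonneg N w). nra.
Qed.

Lemma is_series_eventually_zero (a : nat -> R) (N : nat) :
  (forall n, (N < n)%nat -> a n = 0) -> is_series a (sum_f_R0 a N).
Proof.
  intro H. change (is_lim_seq (sum_n a) (sum_f_R0 a N)).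
  apply is_lim_seq_ext_loc with (fun _ => sum_f_R0 a N); [| apply is_lim_seq_const].
  exists N. intros n Hn. rewrite sum_n_Reals. induction Hn as [| n Hn IH].
  - reflexivity.
  - rewrite tech5, <- IH, H by lia. ring.
Qed.

Lemma supported_l2 (N : nat) (w : Z -> R) :
  supported N w ->
  in_l2 (fun n => RtoC (w n)) /\
  l2_norm (fun n => RtoC (w n)) = sqrt (sumZ N (fun n => w n ^ 2)).
Proof.
  intro Hw.
  assert (E : forall x : R, Cmod (RtoC x) ^ 2 = x ^ 2).
  { intro x. rewrite Cmod_R. apply pow2_abs. }
  assert (H1 : is_series (fun n : nat => Cmod (RtoC (w (Z.of_nat n))) ^ 2)
                 (sum_f_R0 (fun n => w (Z.of_nat n) ^ 2) N)).
  { apply is_series_ext with (fun n : nat => w (Z.of_nat n) ^ 2).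
    - intro n. symmetry. apply E.
    - apply is_series_eventually_zero. intros n Hn. rewrite Hw by lia. lra. }
  assert (H2 : is_series (fun n : nat => Cmod (RtoC (w (- Z.of_nat (S n))%Z)) ^ 2)
                 (sum_f_R0 (fun n => w (- Z.of_nat (S n))%Z ^ 2) N)).
  { apply is_series_ext with (fun n : nat => w (- Z.of_nat (S n))%Z ^ 2).
    - intro n. symmetry. apply E.
    - apply is_series_eventually_zero. intros n Hn. rewrite Hw by lia. lra. }
  split.
  - split; eexists; [exact H1 | exact H2].
  - unfold l2_norm, sumZ. f_equal. f_equal; now apply is_series_unique.
Qed.

Lemma resolvent_bound (lam : R) (f : R -> R) (alpha a : R) :
  in_resolvent_set (schrodinger lam f alpha 0) (RtoC a) ->
  exists M, forall N w, supported N w ->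
    sumZ (S N) (fun n => w n ^ 2)
    <= M * sumZ (S N)
         (fun n => (jacobi 1 (fun n => lam * f (0 + IZR n * alpha)) w n - a * w n) ^ 2).
Proof.
  intros [B [M HB]]. exists (M ^ 2). intros N w Hw.
  set (v := fun n : Z => lam * f (0 + IZR n * alpha)).
  set (p := fun n => jacobi 1 v w n - a * w n).
  assert (HwS := supported_S N w Hw).
  assert (Hp : supported (S N) p).
  { intros n Hn. unfold p. rewrite (supported_jacobi 1 v w N Hw n Hn), (HwS n Hn). ring. }
  destruct (supported_l2 (S N) w HwS) as [Iw Nw].
  destruct (supported_l2 (S N) p Hp) as [Ip Np].
  assert (ET : (fun n => (schrodinger lam f alpha 0 (fun n => RtoC (w n)) n
                          - RtoC a * RtoC (w n))%C) = (fun n => RtoC (p n))).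
  { apply functional_extensionality. intro n. unfold schrodinger, p, jacobi, v.
    rewrite RtoC_minus, RtoC_plus, !RtoC_mult, RtoC_plus. ring. }
  destruct (HB _ Iw) as [_ [_ [_ Hinv]]]. rewrite ET in Hinv.
  destruct (HB _ Ip) as [_ [Hn _]].
  apply functional_extensionality in Hinv. rewrite Hinv, Nw, Np in Hn.
  pose proof (sumZ_sqr_nonneg (S N) w) as H1. pose proof (sumZ_sqr_nonneg (S N) p) as H2.
  change (sumZ (S N) (fun n => w n ^ 2) <= M ^ 2 * sumZ (S N) (fun n => p n ^ 2)).
  rewrite <- (sqrt_sqrt _ H1), <- (sqrt_sqrt _ H2).
  set (A2 := sqrt (sumZ (S N) (fun n => p n ^ 2))) in *.
  replace (M ^ 2 * (A2 * A2)) with ((M * A2) * (M * A2)) by ring.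
  apply Rmult_le_compat; try apply sqrt_pos; exact Hn.
Qed.

(** * Signs of the Dirichlet solution *)

Fixpoint dirichlet (lam : R) (f : R -> R) (alpha E : R) (n : nat) : R * R :=
  match n with
  | O => (0, 1)
  | S k => cocycle lam f E (0 + INR k * alpha) (dirichlet lam f alpha E k)
  end.

Lemma sum_f_R0_last (a : nat -> R) (n : nat) :
  (forall k, (k < n)%nat -> a k = 0) -> sum_f_R0 a n = a n.
Proof.
  intro H. destruct n as [| n]; [easy |].
  rewrite tech5, sum_eq_R0; [ring |]. intros k Hk. apply H. lia.
Qed.

Definition truncate (u : nat -> R) (n : nat) (k : Z) : R :=
  if ((0 <=? k) && (k <=? Z.of_nat n))%Z%bool then u (Z.to_nat k) else 0.

Lemma truncate_nat (u : nat -> R) (n k : nat) :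
  (k <= n)%nat -> truncate u n (Z.of_nat k) = u k.
Proof.
  intro H. unfold truncate. rewrite (proj2 (Z.leb_le _ _)), (proj2 (Z.leb_le _ _)) by lia.
  simpl. now rewrite Nat2Z.id.
Qed.

Lemma truncate_out (u : nat -> R) (n : nat) (k : Z) :
  (k < 0 \/ k > Z.of_nat n)%Z -> truncate u n k = 0.
Proof.
  intro H. unfold truncate.
  destruct (Z.leb_spec 0 k), (Z.leb_spec k (Z.of_nat n)); simpl; easy || lia.
Qed.

Lemma dirichlet_form (lam : R) (f : R -> R) (alpha E : R) (n : nat) :
  let u := fun k => fst (dirichlet lam f alpha E k) in
  let w := truncate u n in
  sumZ n (fun k => w k * jacobi 1 (fun k => lam * f (0 + IZR k * alpha)) w k)
  = E * sumZ n (fun k => w k ^ 2) - u n * u (S n).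
Proof.
  intros u w. set (v := fun k : Z => lam * f (0 + IZR k * alpha)).
  assert (H : sumZ n (fun k => w k * (jacobi 1 v w k - E * w k)) = - (u n * u (S n))).
  { assert (Hu : forall k, u (S k) = (E - v (Z.of_nat k)) * u k
              - match k with O => 1 | S j => u j end).
    { intro k. unfold u, v. rewrite <- INR_IZR_INZ. now destruct k. }
    unfold sumZ. rewrite sum_f_R0_last.
    - rewrite sum_eq_R0.
      + unfold w. rewrite truncate_nat by lia. unfold jacobi. rewrite truncate_nat by lia.
        rewrite (truncate_out u n (Z.of_nat n + 1)) by lia.
        rewrite Hu. destruct n as [| m].
        * rewrite truncate_out by lia. change (u 0%nat) with 0. ring.
        * replace (Z.of_nat (S m) - 1)%Z with (Z.of_nat m) by lia.
          rewrite truncate_nat by lia. ring.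
      + intros k Hk. unfold w at 1. rewrite truncate_out by lia. ring.
    - intros k Hk. unfold w. rewrite truncate_nat by lia. unfold jacobi.
      rewrite truncate_nat by lia.
      replace (Z.of_nat k + 1)%Z with (Z.of_nat (S k)) by lia.
      rewrite truncate_nat by lia. rewrite Hu. destruct k as [| m].
      + change (u 0%nat) with 0. ring.
      + replace (Z.of_nat (S m) - 1)%Z with (Z.of_nat m) by lia.
        rewrite truncate_nat by lia. ring. }
  rewrite (sumZ_ext n _ (fun k => 1 * (w k * (jacobi 1 v w k - E * w k)) + E * w k ^ 2)).
  - rewrite (sumZ_lin n 1 E (fun k => w k * (jacobi 1 v w k - E * w k))
      (fun k => w k ^ 2)), H. ring.
  - intro k. ring.
Qed.

Lemma truncate_supported (u : nat -> R) (n : nat) : supported n (truncate u n).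
Proof. intros k Hk. apply truncate_out. lia. Qed.

Lemma dirichlet_norm_pos (lam : R) (f : R -> R) (alpha E : R) (n : nat) :
  0 < sumZ (S n) (fun k => truncate (fun k => fst (dirichlet lam f alpha E k)) (S n) k ^ 2).
Proof.
  set (u := fun k => fst (dirichlet lam f alpha E k)).
  assert (Hn : 0 <= sum_f_R0 (fun k => truncate u (S n) (- Z.of_nat (S k))%Z ^ 2) (S n)).
  { apply cond_pos_sum. intro. apply pow2_ge_0. }
  assert (Hp : 0 < sum_f_R0 (fun k => truncate u (S n) (Z.of_nat k) ^ 2) (S n)).
  { rewrite decomp_sum by lia. simpl pred.
    assert (H1 : 1 <= sum_f_R0 (fun i => truncate u (S n) (Z.of_nat (S i)) ^ 2) n).
    { apply Rle_trans with (sum_f_R0 (fun i => truncate u (S n) (Z.of_nat (S i)) ^ 2) 0).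
      - change (1 <= truncate u (S n) (Z.of_nat 1) ^ 2). rewrite (truncate_nat u (S n) 1) by lia. unfold u. simpl. lra.
      - destruct n as [| n]; [lra |]. rewrite (decomp_sum _ (S n)) by lia.
        pose proof (cond_pos_sum
          (fun i => truncate u (S (S n)) (Z.of_nat (S (S i))) ^ 2) n
          (fun i => pow2_ge_0 _)) as H0.
        simpl pred. change (sum_f_R0 _ 0) with (truncate u (S (S n)) (Z.of_nat 1) ^ 2). lra. }
    pose proof (pow2_ge_0 (truncate u (S n) (Z.of_nat 0))). lra. }
  unfold sumZ. lra.
Qed.

Lemma dirichlet_alternates_below (lam : R) (f : R -> R) (alpha V Emin E : R) (n : nat) :
  (forall x, Rabs (lam * f x) <= V) -> is_minimum (Sigma lam f alpha) Emin -> E < Emin ->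
  fst (dirichlet lam f alpha E (S n)) * fst (dirichlet lam f alpha E (S (S n))) < 0.
Proof.
  intros HV [_ Hmin] HE.
  pose proof (dirichlet_form lam f alpha E (S n)) as Hf.
  pose proof (dirichlet_norm_pos lam f alpha E n) as Hp.
  cbv zeta in Hf. set (u := fun k => fst (dirichlet lam f alpha E k)) in *.
  assert (Hb : Emin * sumZ (S n) (fun k => truncate u (S n) k ^ 2)
     <= sumZ (S n) (fun k => truncate u (S n) k
          * jacobi 1 (fun k => lam * f (0 + IZR k * alpha)) (truncate u (S n)) k)).
  { apply (jacobi_form_lower_bound 1 V); auto using truncate_supported.
    intros a Ha. apply resolvent_bound. apply NNPP. intro Hs.
    specialize (Hmin a Hs). lra. }
  rewrite Hf in Hb. change (u (S n) * u (S (S n)) < 0). nra.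
Qed.

Lemma dirichlet_constant_sign_above (lam : R) (f : R -> R) (alpha V Emax E : R) (n : nat) :
  (forall x, Rabs (lam * f x) <= V) -> is_maximum (Sigma lam f alpha) Emax -> Emax < E ->
  0 < fst (dirichlet lam f alpha E (S n)) * fst (dirichlet lam f alpha E (S (S n))).
Proof.
  intros HV [_ Hmax] HE.
  pose proof (dirichlet_form lam f alpha E (S n)) as Hf.
  pose proof (dirichlet_norm_pos lam f alpha E n) as Hp.
  cbv zeta in Hf. set (u := fun k => fst (dirichlet lam f alpha E k)) in *.
  set (v := fun k : Z => lam * f (0 + IZR k * alpha)) in *.
  assert (Hb : - Emax * sumZ (S n) (fun k => truncate u (S n) k ^ 2)
     <= sumZ (S n) (fun k => truncate u (S n) k
          * jacobi (-1) (fun k => - v k) (truncate u (S n)) k)).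
  { apply (jacobi_form_lower_bound (-1) V); auto using truncate_supported.
    - intro k. rewrite Rabs_Ropp. apply HV.
    - intros a Ha. destruct (resolvent_bound lam f alpha (- a)) as [M HM].
      + apply NNPP. intro Hs. specialize (Hmax (- a) Hs). lra.
      + exists M. intros N w Hw. specialize (HM N w Hw). fold v in HM.
        rewrite (sumZ_ext (S N) (fun k => (jacobi (-1) (fun k => - v k) w k - a * w k) ^ 2)
          (fun k => (jacobi 1 v w k - - a * w k) ^ 2)); [easy |].
        intro k. unfold jacobi. ring. }
  rewrite (sumZ_ext (S n) (fun k => truncate u (S n) k * jacobi (-1) _ _ k)
    (fun k => (-1) * (truncate u (S n) k * jacobi 1 v (truncate u (S n)) k) + 0 * 0)) in Hb.
  - rewrite (sumZ_lin (S n) (-1) 0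
      (fun k => truncate u (S n) k * jacobi 1 v (truncate u (S n)) k) (fun _ => 0)), Hf in Hb.
    change (0 < u (S n) * u (S (S n))). nra.
  - intro k. unfold jacobi. ring.
Qed.

(** * The rotation number off the spectrum *)

Lemma sin_IZR_PI (j : Z) : sin (IZR j * PI) = 0.
Proof. apply sin_eq_0_1. now exists j. Qed.

Lemma cos_add_IZR_PI (x : R) (j : Z) : cos (x + IZR j * PI) = cos (IZR j * PI) * cos x.
Proof. rewrite cos_plus, sin_IZR_PI. ring. Qed.

Lemma sin_add_IZR_PI (x : R) (j : Z) : sin (x + IZR j * PI) = cos (IZR j * PI) * sin x.
Proof. rewrite sin_plus, sin_IZR_PI. ring. Qed.

Lemma cos_IZR_PI_sqr (j : Z) : cos (IZR j * PI) * cos (IZR j * PI) = 1.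
Proof.
  pose proof (sin2_cos2 (IZR j * PI)) as H. unfold Rsqr in H. rewrite sin_IZR_PI in H. lra.
Qed.

Lemma cos_IZR_PI_even (j k : Z) : cos (IZR (j + 2 * k) * PI) = cos (IZR j * PI).
Proof.
  rewrite plus_IZR, Rmult_plus_distr_r, cos_add_IZR_PI.
  replace (IZR (2 * k) * PI) with (2 * (IZR k * PI)) by (rewrite mult_IZR; ring).
  rewrite cos_2a, sin_IZR_PI, cos_IZR_PI_sqr. ring.
Qed.

Lemma cos_half_turns (t : R) (j : Z) :
  cos (2 * PI * t) = cos (IZR j * PI) * cos (2 * PI * (t - IZR j / 2)).
Proof. rewrite <- cos_add_IZR_PI. f_equal. field. Qed.

Lemma sin_half_turns (t : R) (j : Z) :
  sin (2 * PI * t) = cos (IZR j * PI) * sin (2 * PI * (t - IZR j / 2)).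
Proof. rewrite <- sin_add_IZR_PI. f_equal. field. Qed.

Lemma lift_equations (lam : R) (f : R -> R) (E : R) (psi : R -> R -> R) (x phi : R) :
  is_lift (cocycle lam f E) psi ->
  exists r, 0 < r /\
    (E - lam * f x) * cos (2 * PI * phi) - sin (2 * PI * phi)
      = r * cos (2 * PI * (phi + psi x phi)) /\
    cos (2 * PI * phi) = r * sin (2 * PI * (phi + psi x phi)).
Proof.
  intros [_ H]. destruct (H x phi) as [r [Hr Heq]]. exists r.
  unfold cocycle, direction in Heq. simpl in Heq. injection Heq as H1 H2. auto.
Qed.

(* A rotation by exactly three quarters of a turn would force [v] to be a negative multiple
   of itself in both coordinates. *)
Lemma lift_avoids (lam : R) (f : R -> R) (E : R) (psi : R -> R -> R) (k : Z) (x phi : R) :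
  is_lift (cocycle lam f E) psi -> psi x phi <> IZR k + 3 / 4.
Proof.
  intros Hl Hp. destruct (lift_equations lam f E psi x phi Hl) as [r [Hr [H1 H2]]].
  rewrite Hp in H1, H2. set (a := 2 * PI * phi) in *.
  rewrite (cos_half_turns _ (0 + 2 * k)), cos_IZR_PI_even, Rmult_0_l, cos_0 in H1.
  rewrite (sin_half_turns _ (0 + 2 * k)), cos_IZR_PI_even, Rmult_0_l, cos_0 in H2.
  replace (2 * PI * (phi + (IZR k + 3 / 4) - IZR (0 + 2 * k) / 2))
    with (a + 3 * (PI / 2)) in H1, H2
    by (unfold a; rewrite plus_IZR, mult_IZR; field).
  rewrite cos_plus, cos_3PI2, sin_3PI2 in H1. rewrite sin_plus, cos_3PI2, sin_3PI2 in H2.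
  assert (Hc : cos a = 0) by nra. rewrite Hc in *.
  assert (Hs : sin a = 0) by nra.
  pose proof (sin2_cos2 a) as H3. unfold Rsqr in H3. rewrite Hc, Hs in H3. lra.
Qed.

Lemma lift_offset (lam : R) (f : R -> R) (E : R) (psi : R -> R -> R) :
  is_lift (cocycle lam f E) psi ->
  exists k0 : Z, forall x phi, IZR k0 - 1 / 4 < psi x phi < IZR k0 + 3 / 4.
Proof.
  intro Hl. destruct (archimed (psi 0 0 - 3 / 4)) as [H1 H2].
  set (k0 := up (psi 0 0 - 3 / 4)) in *. exists k0. intros x phi.
  pose (h := fun t => psi (t * x) (t * phi)).
  assert (Hh : continuity h).
  { intro t. apply continuity_pt_filterlim.
    apply (continuous_comp_2 (fun t => t * x) (fun t => t * phi) psi t).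
    - apply (continuous_mult (fun t : R => t) (fun _ => x) t);
        [apply continuous_id | apply continuous_const].
    - apply (continuous_mult (fun t : R => t) (fun _ => phi) t);
        [apply continuous_id | apply continuous_const].
    - apply (proj1 Hl). }
  assert (Hno : forall (k : Z), ~ Rmin (h 0) (h 1) <= IZR k + 3 / 4 <= Rmax (h 0) (h 1)).
  { intros k Hk. destruct (IVT_gen h 0 1 _ Hh Hk) as [t [_ Ht]].
    now apply (lift_avoids lam f E psi k (t * x) (t * phi)). }
  assert (h0 : h 0 = psi 0 0) by (unfold h; now rewrite !Rmult_0_l).
  assert (h1 : h 1 = psi x phi) by (unfold h; now rewrite !Rmult_1_l).
  rewrite h0, h1 in Hno.
  pose proof (Hno k0) as Ha. pose proof (Hno (k0 - 1)%Z) as Hb.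
  rewrite minus_IZR in Hb. unfold Rmin, Rmax in Ha, Hb.
  pose proof (lift_avoids lam f E psi (k0 - 1) 0 0 Hl) as Hc. rewrite minus_IZR in Hc.
  destruct (Rle_dec (psi 0 0) (psi x phi)); split;
    apply Rnot_le_lt; intro; (apply Ha; lra) || (apply Hb; lra).
Qed.

Lemma sin_turn_pos (y : R) : 0 < y < 1 / 2 -> 0 < sin (2 * PI * y).
Proof. intros H. pose proof PI_RGT_0. apply sin_gt_0; nra. Qed.

Lemma sin_turn_neg (y : R) : 1 / 2 < y < 1 -> sin (2 * PI * y) < 0.
Proof. intros H. pose proof PI_RGT_0. apply sin_lt_0; nra. Qed.

Lemma cos_turn_neg (t : R) : 1 / 4 < t < 3 / 4 -> cos (2 * PI * t) < 0.
Proof. intros H. pose proof PI_RGT_0. apply cos_lt_0; nra. Qed.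

Lemma cos_turn_nonneg (t : R) : 3 / 4 <= t <= 1 -> 0 <= cos (2 * PI * t).
Proof. intros H. pose proof PI_RGT_0. apply cos_ge_0_3PI2; nra. Qed.

Lemma cos_turn_nonpos (t : R) : 1 / 4 <= t <= 3 / 4 -> cos (2 * PI * t) <= 0.
Proof. intros H. pose proof PI_RGT_0. apply cos_le_0; nra. Qed.

Lemma sin_turn_neg_inv (y : R) : 0 < y < 3 / 2 -> sin (2 * PI * y) < 0 -> 1 / 2 < y < 1.
Proof.
  intros Hy Hs. pose proof PI_RGT_0. split; apply Rnot_le_lt; intro H1.
  - pose proof (sin_ge_0 (2 * PI * y)). nra.
  - rewrite (sin_half_turns y (0 + 2 * 1)), cos_IZR_PI_even, Rmult_0_l, cos_0 in Hs.
    simpl in Hs. pose proof (sin_ge_0 (2 * PI * (y - 2 / 2))). nra.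
Qed.

Lemma lift_half_plane (lam : R) (f : R -> R) (E : R) (psi : R -> R -> R) (k0 j : Z) (x phi : R) :
  is_lift (cocycle lam f E) psi ->
  IZR k0 - 1 / 4 < psi x phi < IZR k0 + 3 / 4 ->
  1 / 4 < phi - IZR j / 2 < 3 / 4 ->
  1 / 2 < phi + psi x phi - IZR (j + 2 * k0) / 2 < 1.
Proof.
  intros Hl Hk Hphi. destruct (lift_equations lam f E psi x phi Hl) as [r [Hr [_ H]]].
  rewrite (cos_half_turns phi j), (sin_half_turns _ (j + 2 * k0)), cos_IZR_PI_even in H.
  pose proof (cos_turn_neg _ Hphi) as Hc. pose proof (cos_IZR_PI_sqr j) as Hj.
  apply sin_turn_neg_inv.
  - rewrite plus_IZR, mult_IZR. lra.
  - set (C := cos (IZR j * PI)) in *.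
    set (S := sin (2 * PI * (phi + psi x phi - IZR (j + 2 * k0) / 2))) in *.
    set (K := cos (2 * PI * (phi - IZR j / 2))) in *.
    assert (HKS : C * C * K = C * C * (r * S)).
    { rewrite (Rmult_assoc C C K), H. ring. }
    rewrite Hj, !Rmult_1_l in HKS. nra.
Qed.

Lemma lift_iter_direction (lam : R) (f : R -> R) (alpha E : R) (psi : R -> R -> R) (n : nat) :
  is_lift (cocycle lam f E) psi ->
  exists r, 0 < r /\ dirichlet lam f alpha E n =
    (r * cos (2 * PI * lift_iter alpha psi 0 (1 / 4) n),
     r * sin (2 * PI * lift_iter alpha psi 0 (1 / 4) n)).
Proof.
  intro Hl. induction n as [| n [r [Hr IH]]].
  - exists 1. split; [lra |]. simpl. replace (2 * PI * (1 / 4)) with (PI / 2) by field.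
    rewrite cos_PI2, sin_PI2. f_equal; ring.
  - simpl lift_iter. set (phi := lift_iter alpha psi 0 (1 / 4) n) in *.
    destruct (lift_equations lam f E psi (0 + INR n * alpha) phi Hl) as [q [Hq [H1 H2]]].
    exists (r * q). split; [nra |]. simpl. rewrite IH. unfold cocycle. simpl.
    f_equal.
    + rewrite (Rmult_assoc r q), <- H1. ring.
    + rewrite H2. ring.
Qed.

Lemma average_unique (a : nat -> R) (C q l : R) :
  (forall n, (0 < n)%nat -> Rabs (a n - INR n * q) <= C) ->
  is_lim_seq (fun n => a n / INR n) l -> l = q.
Proof.
  intros H Hl.
  assert (Hq : is_lim_seq (fun n => a n / INR n) q).
  { apply is_lim_seq_incr_1.
    assert (Hi : is_lim_seq (fun n => / INR (S n)) 0).
    { apply (is_lim_seq_incr_1 (fun n => / INR n)).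
      apply (is_lim_seq_inv INR p_infty); [apply is_lim_seq_INR | easy]. }
    assert (Hc : forall c, is_lim_seq (fun n => q + c * / INR (S n)) q).
    { intro c. replace (Finite q) with (Finite (q + c * 0)) by (f_equal; ring).
      apply is_lim_seq_plus'; [apply is_lim_seq_const |].
      now apply (is_lim_seq_scal_l _ c 0). }
    apply is_lim_seq_le_le with (2 := Hc (- C)) (3 := Hc C).
    intro n. specialize (H (S n) (Nat.lt_0_succ n)).
    apply Rabs_le_between in H.
    assert (Hn : 0 < / INR (S n)) by (apply Rinv_0_lt_compat, lt_0_INR; lia).
    replace (a (S n) / INR (S n)) with (q + (a (S n) - INR (S n) * q) * / INR (S n)).
    - split; apply Rplus_le_compat_l, Rmult_le_compat_r; lra.
    - field. apply not_0_INR. lia. }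
  apply is_lim_seq_unique in Hl. apply is_lim_seq_unique in Hq.
  rewrite Hl in Hq. now injection Hq.
Qed.

(* [e = 0] if the Dirichlet solution keeps its sign and [e = 1] if it alternates. *)
Lemma rotation_number_half_integer (lam : R) (f : R -> R) (alpha E l : R)
    (psi : R -> R -> R) (e : Z) :
  let u := fun n => fst (dirichlet lam f alpha E n) in
  is_lift (cocycle lam f E) psi ->
  is_lim_seq (fun n => (lift_iter alpha psi 0 (1 / 4) n - 1 / 4) / INR n) l ->
  (e = 0%Z /\ forall n, 0 < u (S n) * u (S (S n))) \/
  (e = 1%Z /\ forall n, u (S n) * u (S (S n)) < 0) ->
  exists k : Z, 2 * l = IZR k.
Proof.
  intros u Hl Hlim He. destruct (lift_offset lam f E psi Hl) as [k0 Hk0].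
  set (phi := lift_iter alpha psi 0 (1 / 4)) in *.
  assert (HS : forall n, phi (S n) = phi n + psi (0 + INR n * alpha) (phi n)) by reflexivity.
  pose (j := fun n : nat => (2 * k0 + Z.of_nat n * (2 * k0 + e))%Z).
  assert (Hphi : forall n, 1 / 4 < phi (S n) - IZR (j n) / 2 < 3 / 4).
  { intro n. induction n as [| n IH].
    - assert (H0 : phi 1%nat = 1 / 4 + psi (0 + INR 0 * alpha) (1 / 4)) by reflexivity.
      pose proof (Hk0 (0 + INR 0 * alpha) (1 / 4)) as Hk.
      destruct (lift_equations lam f E psi (0 + INR 0 * alpha) (1 / 4) Hl)
        as [r [Hr [_ H]]].
      rewrite <- H0 in H.
      replace (2 * PI * (1 / 4)) with (PI / 2) in H by field. rewrite cos_PI2 in H.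
      rewrite (sin_half_turns _ (0 + 2 * k0)), cos_IZR_PI_even, Rmult_0_l, cos_0 in H.
      replace (j 0%nat) with (0 + 2 * k0)%Z by (unfold j; lia).
      assert (Hy : 0 < phi 1%nat - IZR (0 + 2 * k0) / 2 < 1).
      { rewrite H0, plus_IZR, mult_IZR. lra. }
      set (y := phi 1%nat - IZR (0 + 2 * k0) / 2) in *.
      destruct (Rtotal_order y (1 / 2)) as [Hlt | [-> | Hgt]]; [| lra |].
      + pose proof (sin_turn_pos y). nra.
      + pose proof (sin_turn_neg y). nra.
    - pose proof (lift_half_plane lam f E psi k0 (j n) (0 + INR (S n) * alpha) (phi (S n))
        Hl (Hk0 _ _) IH) as Hy. rewrite <- HS in Hy.
      destruct (lift_iter_direction lam f alpha E psi (S n) Hl) as [r1 [Hr1 E1]].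
      destruct (lift_iter_direction lam f alpha E psi (S (S n)) Hl) as [r2 [Hr2 E2]].
      apply (f_equal fst) in E1. apply (f_equal fst) in E2.
      change (u (S n) = r1 * cos (2 * PI * phi (S n))) in E1.
      change (u (S (S n)) = r2 * cos (2 * PI * phi (S (S n)))) in E2.
      rewrite (cos_half_turns _ (j n)) in E1.
      rewrite (cos_half_turns _ (j n + 2 * k0)), cos_IZR_PI_even in E2.
      pose proof (cos_turn_neg _ IH) as Hc1.
      set (y := phi (S (S n)) - IZR (j n + 2 * k0) / 2) in *.
      assert (Hj : IZR (j (S n)) = IZR (j n + 2 * k0) + IZR e).
      { rewrite <- plus_IZR. f_equal. unfold j. lia. }
      rewrite Hj.
      replace (phi (S (S n)) - (IZR (j n + 2 * k0) + IZR e) / 2) with (y - IZR e / 2)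
        by (unfold y; field).
      set (c1 := cos (2 * PI * (phi (S n) - IZR (j n) / 2))) in *.
      assert (Hprod : u (S n) * u (S (S n)) = (r1 * r2) * (c1 * cos (2 * PI * y))).
      { rewrite E1, E2. pose proof (cos_IZR_PI_sqr (j n)) as HC.
        set (C := cos (IZR (j n) * PI)) in *.
        replace (r1 * (C * c1) * (r2 * (C * cos (2 * PI * y))))
          with (C * C * (r1 * r2 * (c1 * cos (2 * PI * y)))) by ring.
        rewrite HC. ring. }
      assert (Hr : 0 < r1 * r2) by nra.
      destruct He as [[-> He] | [-> He]]; specialize (He n); rewrite Hprod in He.
      + split; [lra |]. apply Rnot_le_lt. intro Hge.
        pose proof (cos_turn_nonneg y ltac:(lra)).
        assert (Hcy : c1 * cos (2 * PI * y) <= 0) by nra. nra.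
      + split; [| lra]. apply Rnot_le_lt. intro Hle.
        pose proof (cos_turn_nonpos y ltac:(lra)).
        assert (Hcy : 0 <= c1 * cos (2 * PI * y)) by nra. nra. }
  exists (2 * k0 + e)%Z.
  replace l with (IZR (2 * k0 + e) / 2); [field |].
  symmetry. apply (average_unique (fun n => phi n - 1 / 4) 1); [| exact Hlim].
  intros [| n] Hn; [lia |]. specialize (Hphi n). unfold j in Hphi.
  rewrite plus_IZR, !mult_IZR, <- INR_IZR_INZ in Hphi. rewrite S_INR.
  rewrite plus_IZR, mult_IZR in *.
  apply Rabs_le. destruct He as [[-> _] | [-> _]]; lra.
Qed.

(** * Separation of the gaps *)

Lemma rotation_number_outside (lam : R) (f : R -> R) (alpha Emin Emax E : R) (rho : R -> R) :
  one_periodic f -> continuity f ->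
  is_minimum (Sigma lam f alpha) Emin -> is_maximum (Sigma lam f alpha) Emax ->
  is_fibered_rotation_number lam f alpha rho -> gap0 Emin Emax E ->
  exists k : Z, 2 * rho E = IZR k.
Proof.
  intros Hp Hc Hmin Hmax Hrho HE.
  destruct (periodic_continuous_bounded f Hp Hc) as [V0 HV0].
  assert (HV : forall x, Rabs (lam * f x) <= Rabs lam * V0).
  { intro x. rewrite Rabs_mult. apply Rmult_le_compat_l; [apply Rabs_pos | apply HV0]. }
  destruct (Hrho E) as [_ [psi [Hl Hlim]]]. specialize (Hlim 0 (1 / 4)).
  destruct HE as [HE | HE].
  - apply (rotation_number_half_integer lam f alpha E (rho E) psi 1 Hl Hlim).
    right. split; [easy |]. intro n. eapply dirichlet_alternates_below; eauto.
  - apply (rotation_number_half_integer lam f alpha E (rho E) psi 0 Hl Hlim).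
    left. split; [easy |]. intro n. eapply dirichlet_constant_sign_above; eauto.
Qed.

Lemma dist_Z_multiple_le (alpha : R) (p j : Z) :
  dist_Z (INR (Z.abs_nat p) * alpha) <= Rabs (IZR p * alpha + IZR j).
Proof.
  rewrite INR_IZR_INZ, Zabs2Nat.id_abs. destruct (Z.abs_eq_or_opp p) as [-> | ->].
  - replace (IZR p * alpha + IZR j) with (IZR p * alpha - IZR (- j)) by (rewrite opp_IZR; ring).
    apply dist_Z_le.
  - replace (IZR p * alpha + IZR j) with (- (IZR (- p) * alpha - IZR j))
      by (rewrite opp_IZR; ring).
    rewrite Rabs_Ropp. apply dist_Z_le.
Qed.

Lemma gap_closure (Em Ep : Z -> R) (m : Z) (E : R) : gap Em Ep m E -> Em m <= E <= Ep m.
Proof. intros [H | [H ->]]; lra. Qed.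

Lemma set_dist_ge (A B : R -> Prop) (c : R) :
  (forall x y, A x -> B y -> c <= Rabs (x - y)) -> Rbar_le c (set_dist A B).
Proof. intro H. apply le_Glb_Rbar. intros d (x & y & Hx & Hy & ->). now apply H. Qed.

(* Along multiples [p alpha] with [|p| <= 2 M] the distance to [Z] is at least
   [c exp (- 4 beta M)], and the Hoelder exponent 1/2 doubles the rate. *)
Lemma energy_separation (alpha Cstar : R) (rho : R -> R) :
  irrational alpha -> Rbar_lt 0 (beta alpha) -> Rbar_lt (beta alpha) p_infty ->
  (forall E1 E2, Rabs (rho E1 - rho E2) <= Cstar * sqrt (Rabs (E1 - E2))) ->
  exists cstar, 0 < cstar /\
    forall (p j M : Z) (E1 E2 : R), p <> 0%Z -> (Z.abs p <= 2 * M)%Z ->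
      2 * rho E1 - 2 * rho E2 = IZR p * alpha + IZR j ->
      cstar * exp (- 8 * real (beta alpha) * IZR M) <= Rabs (E1 - E2).
Proof.
  intros Ha H0 Hinf HC.
  destruct (dist_Z_multiple_lower_bound alpha Ha H0 Hinf) as [c [Hc Hd]].
  assert (Hb : 0 < real (beta alpha)) by (destruct (beta alpha); simpl in *; easy).
  set (b := real (beta alpha)) in *.
  set (D := Rmax Cstar 1). assert (HD : 1 <= D) by apply Rmax_r.
  assert (HDi : 0 < / (2 * D)) by (apply Rinv_0_lt_compat; lra).
  assert (HcD : 0 < c * / (2 * D)) by nra.
  exists ((c * / (2 * D)) ^ 2). split; [nra |].
  intros p j M E1 E2 Hp HM Hrho.
  specialize (Hd (Z.abs_nat p) ltac:(lia)).
  pose proof (dist_Z_multiple_le alpha p j) as Hle.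
  rewrite <- Hrho, <- Rmult_minus_distr_l, Rabs_mult, (Rabs_right 2) in Hle by lra.
  pose proof (sqrt_pos (Rabs (E1 - E2))) as Hs.
  assert (H1 : Rabs (rho E1 - rho E2) <= D * sqrt (Rabs (E1 - E2))).
  { eapply Rle_trans; [apply HC |]. apply Rmult_le_compat_r; [easy | apply Rmax_l]. }
  assert (H2 : c * exp (- 4 * b * IZR M) <= c * exp (- 2 * b * INR (Z.abs_nat p))).
  { apply Rmult_le_compat_l; [lra |]. apply Rnot_lt_le. intro Hlt.
    apply exp_lt_inv in Hlt. rewrite INR_IZR_INZ, Zabs2Nat.id_abs in Hlt.
    apply IZR_le in HM. rewrite mult_IZR in HM. nra. }
  assert (H3 : c * / (2 * D) * exp (- 4 * b * IZR M) <= sqrt (Rabs (E1 - E2))).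
  { apply Rmult_le_reg_l with (2 * D); [lra |].
    replace (2 * D * (c * / (2 * D) * exp (- 4 * b * IZR M)))
      with (c * exp (- 4 * b * IZR M)) by (field; lra).
    lra. }
  rewrite <- (sqrt_sqrt (Rabs (E1 - E2))) by apply Rabs_pos.
  replace (- 8 * b * IZR M) with (- 4 * b * IZR M + - 4 * b * IZR M) by ring.
  rewrite exp_plus.
  replace ((c * / (2 * D)) ^ 2 * (exp (- 4 * b * IZR M) * exp (- 4 * b * IZR M)))
    with (c * / (2 * D) * exp (- 4 * b * IZR M) * (c * / (2 * D) * exp (- 4 * b * IZR M)))
    by ring.
  pose proof (exp_pos (- 4 * b * IZR M)).
  apply Rmult_le_compat; nra.
Qed.

Theorem lemma5p3
    (C1 C2 : R) (lambda0 : (R -> R) -> R -> R -> R)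
    (hC : LiuYuan_constants C1 C2 lambda0)
    (alpha eta lam : R) (f : R -> R)
    (halpha : irrational alpha)
    (hbeta_pos : Rbar_lt 0 (beta alpha))
    (hbeta_fin : Rbar_lt (beta alpha) p_infty)
    (heta : C1 * real (beta alpha) < eta)
    (hf_per : one_periodic f)
    (hf_an : real_analytic f)
    (hf_strip : analytic_on_strip f (C2 * eta))
    (hlam : 0 < Rabs lam <= lambda0 f eta alpha)
    (Emin Emax : R)
    (hEmin : is_minimum (Sigma lam f alpha) Emin)
    (hEmax : is_maximum (Sigma lam f alpha) Emax)
    (rho : R -> R) (hrho : is_fibered_rotation_number lam f alpha rho)
    (Em Ep : Z -> R) (hE : is_gap_endpoints alpha rho Em Ep) :
  exists cstar : R, 0 < cstar /\
    (forall m m' : Z,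
       m <> 0%Z -> m' <> 0%Z -> m' <> m -> (Z.abs m <= Z.abs m')%Z ->
       Rbar_le (cstar * exp (- 8 * real (beta alpha) * IZR (Z.abs m')))
               (set_dist (gap Em Ep m) (gap Em Ep m'))) /\
    (forall m : Z, m <> 0%Z ->
       Rbar_le (cstar * exp (- 8 * real (beta alpha) * IZR (Z.abs m)))
               (set_dist (gap Em Ep m) (gap0 Emin Emax))).
Proof.
  destruct hC as [_ [_ HLY]].
  destruct (HLY alpha eta f halpha hbeta_pos hbeta_fin heta hf_per hf_an hf_strip)
    as [_ HLY'].
  destruct (HLY' lam rho hlam hrho) as [Cstar HC].
  destruct (energy_separation alpha Cstar rho halpha hbeta_pos hbeta_fin HC)
    as [cstar [Hc Hsep]].
  exists cstar. split; [exact Hc |]. split.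
  - intros m m' Hm Hm' Hne Hle. apply set_dist_ge. intros E E' HE HE'.
    apply gap_closure, (proj2 (hE m Hm)) in HE. destruct HE as [k HE].
    apply gap_closure, (proj2 (hE m' Hm')) in HE'. destruct HE' as [k' HE'].
    apply (Hsep (m - m')%Z (k - k')%Z); [lia | lia |].
    rewrite HE, HE', !minus_IZR. ring.
  - intros m Hm. apply set_dist_ge. intros E E' HE HE'.
    apply gap_closure, (proj2 (hE m Hm)) in HE. destruct HE as [k HE].
    destruct (rotation_number_outside lam f alpha Emin Emax E' rho) as [k' HE''];
      auto using real_analytic_continuity.
    apply (Hsep m (k - k')%Z); [lia | lia |].
    rewrite HE, HE'', minus_IZR. ring.
Qed.
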